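(* Let $K$ be a field of characteristic $0$. Let $M'$ be an $m\times(n'+1)$ multiplicity matrix that is not the multiplicity matrix of a polynomial in $K[x]$. Let $\ell\ge0$ and $n=n'+\ell$. If $M$ is an $m\times(n+1)$ multiplicity matrix whose $\ell$-truncation is $M'$, then $M$ is not the multiplicity matrix of a polynomial in $K[x]$.
   Context: For a polynomial $f$ of degree $d$ and a sequence $\Lambda=(\lambda_1,\ldots,\lambda_m)$ of distinct elements of $K$, the multiplicity matrix $M_f(\Lambda)$ is the $m\times(d+1)$ matrix (rows $i\in\{1,\ldots,m\}$, columns $j\in\{0,\ldots,d\}$) whose $(i,j)$ entry is the multiplicity of $\lambda_i$ as a zero of $f^{(j)}(x)$ (which is $0$ if $f^{(j)}(\lambda_i)\neq0$). A matrix $M$ is the multiplicity matrix of a polynomial if there exist a polynomial $f\in K[x]$ and a sequence $\Lambda$ of distinct elements of $K$ with $M=M_f(\Lambda)$. An $m\times(n+1)$ multiplicity matrix is a matrix $(\mu_{i,j})$ of nonnegative integers (columns $j=0,\ldots,n$) such that each row satisfies $\mu_{i,n}=0$ and $\mu_{i,j}\ge1\Rightarrow\mu_{i,j+1}=\mu_{i,j}-1$, and $\sum_{i=1}^m\mu_{i,j}\le n-j$ for all $j$. The $\ell$-truncation of an $m\times(n+1)$ matrix is the $m\times(n+1-\ell)$ submatrix obtained by deleting its first $\ell$ columns. *)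

(* Defs.v *)
From HB Require Import structures.
From mathcomp Require Import all_boot all_order all_algebra.

Set Implicit Arguments.
Unset Strict Implicit.
Unset Printing Implicit Defensive.

Import GRing.Theory.
Local Open Scope ring_scope.

(* Intended for f of degree exactly d, i.e. size f = d.+1. *)
Definition poly_multmx (K : fieldType) (m d : nat) (f : {poly K})
    (Lambda : m.-tuple K) : 'M[nat]_(m, d.+1) :=
  \matrix_(i < m, j < d.+1) mup (tnth Lambda i) f^`(j).

(* M_f(Lambda) has deg f + 1 columns, so M = M_f(Lambda) forces deg f = n. *)
Definition is_poly_multmx (K : fieldType) (m n : nat)
    (M : 'M[nat]_(m, n.+1)) : Prop :=
  exists (f : {poly K}) (Lambda : m.-tuple K),
    [/\ size f = n.+1, uniq Lambda & M = poly_multmx n f Lambda].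

Definition multmx (m n : nat) (M : 'M[nat]_(m, n.+1)) : Prop :=
  [/\ forall i : 'I_m, M i ord_max = 0%N,
      forall (i : 'I_m) (j k : 'I_n.+1), val k = (val j).+1 ->
        (1 <= M i j)%N -> M i k = (M i j - 1)%N
    & forall j : 'I_n.+1, (\sum_(i < m) M i j <= n - j)%N].

(* inord never defaults here, since l + j <= n' + l for j : 'I_n'.+1. *)
Definition truncation (m n' l : nat) (M : 'M[nat]_(m, (n' + l).+1)) :
    'M[nat]_(m, n'.+1) :=
  \matrix_(i < m, j < n'.+1) M i (inord (l + j)).

Arguments is_poly_multmx K {m n} M.
Arguments truncation {m n'} l M.

(* Main.v *)
Require Import Defs.
From HB Require Import structures.
From mathcomp Require Import all_boot all_order all_algebra.

Import GRing.Theory.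
Local Open Scope ring_scope.

(** By contraposition: if [f] and [Lambda] realise [M], then
    [f^](l)[and the same]Lambda[realise]M'[. Characteristic 0 ensures that]f^[(l)] has degree
    exactly [n'] ([size_derivn_pchar0]). *)

Lemma derivnD (R : nzRingType) (p : {poly R}) (a b : nat) :
  p^`(a)^`(b) = p^`(a + b).
Proof. by rewrite /derivn addnC iterD. Qed.

Lemma size_derivn_pchar0 (K : fieldType) (p : {poly K}) (d l : nat) :
  [pchar K] =i pred0 -> size p = (d + l).+1 -> size p^`(l) = d.+1.
Proof.
move=> charK0 szp; apply/eqP; rewrite eqn_leq; apply/andP; split.
  apply/leq_sizeP => j le_dj; rewrite coef_derivn nth_default ?mul0rn //.
  by rewrite szp -addSn addnC leq_add2l.
rewrite ltnNge; apply/negP => /leq_sizeP /(_ d (leqnn d)) /eqP.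
rewrite coef_derivn -mulr_natr mulf_eq0 => /orP [|].
  by rewrite addnC -[(d + l)%N]/((d + l).+1.-1) -szp -lead_coefE lead_coef_eq0
     -size_poly_eq0 szp.
by move/pcharf0P: charK0 => ->; rewrite -leqn0 leqNgt ffact_gt0 leq_addr.
Qed.

(* The [l]-truncation of [M_f(Lambda)] is the multiplicity matrix of the [l]-th
   derivative of [f], which has degree exactly [n'] in characteristic 0. *)
Theorem theorem7 (K : fieldType) (charK0 : [pchar K] =i pred0)
    (m n' l : nat) (M' : 'M[nat]_(m, n'.+1)) (M : 'M[nat]_(m, (n' + l).+1)) :
  multmx M' -> ~ is_poly_multmx K M' ->
  multmx M -> truncation l M = M' ->
  ~ is_poly_multmx K M.
Proof.
move=> _ notM' _ truncM [f [Lambda [szf uniqL defM]]].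
apply: notM'; rewrite -truncM; exists f^`(l), Lambda; split=> //.
  exact: size_derivn_pchar0.
(* Column [j] of the truncation is column [l + j] of [M], and [f^](l +
   j)[is the]j[-th derivative of]f^[(l)]. *)
apply/matrixP => i j; rewrite defM !mxE derivnD inordK //.
by rewrite addnC ltnS leq_add2r -ltnS.
Qed.
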